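(* In the (universal) hyperbolic plane with absolute conic $\mathcal{N}\colon x_1^2+x_2^2-x_0^2=0$, let $$\mathcal{C}\colon \lambda(x_1^2+x_2^2-x_0^2)+(x_0+x_1)x_2=0,\qquad \lambda\in\mathbb{R}\setminus\{0\},$$ be an osculating parabola. Then the Frégier locus of $\mathcal{C}$ is never singular, i.e. it is a regular conic for every $\lambda\in\mathbb{R}\setminus\{0\}$.
   Context: Points have homogeneous coordinates $[x_0,x_1,x_2]$; points inside and outside $\mathcal{N}$ are treated equally, and the Frégier locus is considered in the complex projective plane. Two lines are orthogonal if they are conjugate with respect to $\mathcal{N}$ (one contains the pole of the other with respect to $\mathcal{N}$). A conic is regular if its symmetric coefficient matrix is invertible. An osculating parabola is a conic $\mathcal{C}$ for which exactly three of the four base points of the pencil spanned by $\mathcal{C}$ and $\mathcal{N}$ coincide. For a regular conic $\mathcal{C}$ and $p\in\mathcal{C}$, the Frégier point $f(\mathcal{C},p)$ is the point common to the hypotenuses $q\vee r$ of all right triangles $p,q,r$ inscribed into $\mathcal{C}$ with right angle at $p$; equivalently, it is the pole with respect to $\mathcal{C}$ of the line joining the second intersection points with $\mathcal{C}$ of the two (possibly complex) tangents of $\mathcal{N}$ through $p$ (if these second intersection points coincide, the line is the tangent of $\mathcal{C}$ there; in particular $f(\mathcal{C},p)=p$ if $\mathcal{C}$ and $\mathcal{N}$ are tangent at $p$). The Frégier locus is $\mathcal{F}=\{f(\mathcal{C},p)\mid p\in\mathcal{C}\}$; it is called singular if it is not a regular conic. *)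

(* Defs.v *)
From mathcomp Require Import all_boot all_order all_algebra.
From mathcomp Require Import complex ring.
From mathcomp Require Import boolp classical_sets reals.

Set Implicit Arguments.
Unset Strict Implicit.
Unset Printing Implicit Defensive.

Import GRing.Theory.
Local Open Scope classical_set_scope.
Local Open Scope ring_scope.

(* The projective plane over K. A point is a nonzero row vector of homogeneous
   coordinates [x_0, x_1, x_2]; two of them are the same point when
   (x == y)%MS, that is, when they are proportional. The line joining two
   points p and q is the row space (p + q)%MS, and a point x lies on a line L
   when (x <= L)%MS. A conic is given by its symmetric coefficient matrix. *)
Section ProjectivePlane.
Variable K : fieldType.
Implicit Types (A M : 'M[K]_3) (p q r f g x : 'rV[K]_3).

Definition qform A x : K := (x *m A *m x^T) 0 0.

(* Sets of points are sets of all their homogeneous coordinate vectors. *)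
Definition conic_points A : set 'rV[K]_3 :=
  [set x | x != 0 /\ qform A x = 0].

Definition regular_coef A : Prop := A^T = A /\ A \in unitmx.

Definition regular_conic (F : set 'rV[K]_3) : Prop :=
  exists M, regular_coef M /\ F = conic_points M.

Definition is_pole A x m (L : 'M[K]_(m, 3)) : Prop :=
  x != 0 /\ L *m A *m x^T = 0.

(* x_1^2 + x_2^2 - x_0^2 *)
Definition absolute : 'M[K]_3 :=
  \matrix_(i < 3, j < 3)
    (nth [::] [:: [:: -1; 0; 0];
                  [::  0; 1; 0];
                  [::  0; 0; 1]] i)`_j.

(* For lines L1, L2; the relation is symmetric since absolute is. *)
Definition orthogonal_lines m1 m2 (L1 : 'M[K]_(m1, 3)) (L2 : 'M[K]_(m2, 3)) :
    Prop :=
  exists x, is_pole absolute x L1 /\ (x <= L2)%MS.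

(* Rank 3 says that p, q, r are three non-collinear points. *)
Definition inscribed_right_triangle A p q r : Prop :=
  [/\ \rank (p + q + r)%MS = 3%N,
      [/\ conic_points A p, conic_points A q & conic_points A r]
    & orthogonal_lines (p + q)%MS (p + r)%MS].

Definition on_all_hypotenuses A p f : Prop :=
  f != 0 /\
  forall q r, inscribed_right_triangle A p q r -> (f <= q + r)%MS.

(* p *m A is the coordinate vector of the tangent of A at p. *)
Definition tangent_to_absolute_at A p : Prop :=
  [/\ conic_points A p, conic_points absolute p
    & (p *m A == p *m absolute)%MS].

(* No right triangle with right angle at p is inscribed into A when A and the
   absolute conic are tangent at p: of two orthogonal lines through p, one is
   then the common tangent, which does not meet A again. The Fregier point is p
   in this case, because the tangents of the absolute conic through p coincide
   and have p as second intersection point with A. At the other points of A,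
   including those where A crosses the absolute conic, exactly one point is
   common to all hypotenuses when A is regular and K is the complex field. *)
Definition is_fregier_point A p f : Prop :=
  (tangent_to_absolute_at A p /\ f != 0 /\ (f == p)%MS) \/
  (~ tangent_to_absolute_at A p /\ on_all_hypotenuses A p f /\
   forall g, on_all_hypotenuses A p g -> (g == f)%MS).

Definition fregier_locus A : set 'rV[K]_3 :=
  [set f | exists2 p, conic_points A p & is_fregier_point A p f].

(* lambda (x_1^2 + x_2^2 - x_0^2) + (x_0 + x_1) x_2 *)
Definition osc_conic (lambda : K) : 'M[K]_3 :=
  \matrix_(i < 3, j < 3)
    (nth [::] [:: [:: - lambda; 0;      2^-1];
                  [:: 0;        lambda; 2^-1];
                  [:: 2^-1;     2^-1;   lambda]] i)`_j.

(* The absolute conic is parametrised by the projective line, so the base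
   points of the pencil spanned by A and the absolute conic are, with
   multiplicity, the zeros of the binary quartic form obtained by restricting
   A to this parametrisation. *)
Definition absolute_param (s t : K) : 'rV[K]_3 :=
  \row_(j < 3) [:: s ^+ 2 + t ^+ 2; s ^+ 2 - t ^+ 2; 2 * s * t]`_j.

Definition osculating_parabola A : Prop :=
  A^T = A /\
  exists a b c d : K, a * d - b * c != 0 /\
    forall s t, qform A (absolute_param s t) =
                (a * s + b * t) ^+ 3 * (c * s + d * t).

Lemma qformE A x : qform A x = \sum_j (\sum_i x 0 i * A i j) * x 0 j.
Proof. by rewrite /qform mxE; apply: eq_bigr => j _; rewrite !mxE. Qed.

Lemma big_ord3 (F : 'I_3 -> K) : \sum_i F i = F 0 + F 1 + F 2.
Proof.
rewrite !big_ord_recl big_ord0 addr0 addrA.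
by congr (F _ + F _ + F _); apply: val_inj.
Qed.

Lemma qform_absolute x :
  qform absolute x = x 0 1 ^+ 2 + x 0 2 ^+ 2 - x 0 0 ^+ 2.
Proof.
by rewrite qformE !big_ord3 !mxE /=; ring.
Qed.

Lemma qform_osc_conic lambda x : 2 != 0 :> K ->
  qform (osc_conic lambda) x =
  lambda * (x 0 1 ^+ 2 + x 0 2 ^+ 2 - x 0 0 ^+ 2) + (x 0 0 + x 0 1) * x 0 2.
Proof.
move=> nz2; rewrite qformE !big_ord3 !mxE /=.
by field.
Qed.

Lemma osc_conic_sym lambda : (osc_conic lambda)^T = osc_conic lambda.
Proof.
by apply/matrixP=> -[[|[|[|i]]] ?] -[[|[|[|j]]] ?]; rewrite !mxE.
Qed.

Lemma osc_conic_regular lambda : 2 != 0 :> K -> lambda != 0 ->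
  regular_coef (osc_conic lambda).
Proof.
move=> nz2 nz; split; first exact: osc_conic_sym.
pose B : 'M[K]_3 := \matrix_(i < 3, j < 3)
  (- lambda ^- 3 *
   (nth [::] [:: [:: lambda ^+ 2 - 4^-1; 4^-1;                   - (lambda / 2)];
                 [:: 4^-1;               - lambda ^+ 2 - 4^-1;     lambda / 2];
                 [:: - (lambda / 2);     lambda / 2;         - lambda ^+ 2]] i)`_j).
have nz4 : 4 != 0 :> K by rewrite (_ : 4 = 2 * 2) ?mulf_neq0 //; ring.
suff /mulmx1_unit[] : osc_conic lambda *m B = 1%:M by [].
apply/matrixP=> -[[|[|[|i]]] ?] -[[|[|[|j]]] ?] //;
  by rewrite mxE big_ord3 !mxE /=; field; rewrite ?nz2 ?nz4 ?nz.
Qed.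

Lemma osc_conic_osculating lambda : 2 != 0 :> K ->
  osculating_parabola (osc_conic lambda).
Proof.
move=> nz2; split; first exact: osc_conic_sym.
exists 1, 0, 0, 4; rewrite mul1r mulr0 subr0; split=> [|s t].
  by rewrite (_ : 4 = 2 * 2) ?mulf_neq0 //; ring.
by rewrite qform_osc_conic // !mxE /=; ring.
Qed.

End ProjectivePlane.

Arguments absolute {K}.

(* Main.v *)
Require Import Defs.
From mathcomp Require Import all_boot all_order all_algebra.
From mathcomp Require Import ring.
From mathcomp Require Import complex boolp classical_sets reals.

Set Implicit Arguments.
Unset Strict Implicit.
Unset Printing Implicit Defensive.

Import GRing.Theory.
Local Open Scope ring_scope.

(* Write A and N for the coefficient matrices of the conic and of the absolute
   conic. The Fregier point of p is the image of p under the collineation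
   F = 2 A N^-1 - tr(A N^-1) I. For the osculating parabola, F is the sum of the
   scalar matrix -lambda I and of a nilpotent matrix, hence invertible for
   lambda <> 0, and the Fregier locus is the regular conic F(C). *)

(** * Incidence of points and lines through 3 by 3 determinants *)

Section Plane.
Variable K : fieldType.
Implicit Types (A : 'M[K]_3) (p q r f g x y : 'rV[K]_3).

Definition vec3 (a b c : K) : 'rV[K]_3 := \row_(j < 3) [:: a; b; c]`_j.

Lemma rowvec3P x y :
  [/\ x 0 0 = y 0 0, x 0 1 = y 0 1 & x 0 2 = y 0 2] -> x = y.
Proof.
move=> [e0 e1 e2]; apply/rowP=> -[[|[|[|j]]] ltj] //.
- by rewrite (_ : Ordinal ltj = 0) //; apply: val_inj.
- by rewrite (_ : Ordinal ltj = 1) //; apply: val_inj.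
- by rewrite (_ : Ordinal ltj = 2) //; apply: val_inj.
Qed.

Lemma vec3E x : x = vec3 (x 0 0) (x 0 1) (x 0 2).
Proof. by apply: rowvec3P; rewrite !mxE. Qed.

Definition det3 p q r : K := \det (col_mx p (col_mx q r)).

Lemma det3E p q r : det3 p q r =
  p 0 0 * (q 0 1 * r 0 2 - q 0 2 * r 0 1)
  - p 0 1 * (q 0 0 * r 0 2 - q 0 2 * r 0 0)
  + p 0 2 * (q 0 0 * r 0 1 - q 0 1 * r 0 0).
Proof.
have E : col_mx p (col_mx q r) = \matrix_(i < 3, j < 3)
    ([:: vec3 (p 0 0) (p 0 1) (p 0 2); vec3 (q 0 0) (q 0 1) (q 0 2);
         vec3 (r 0 0) (r 0 1) (r 0 2)]`_i 0 j).
  apply/matrixP=> i j; rewrite -!vec3E !mxE.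
  case: splitP => [i'|k] /= ->; first by rewrite (ord1 i').
  by rewrite mxE; case: splitP => i' /= ->; rewrite (ord1 i').
rewrite /det3 E (expand_det_row _ 0) big_ord3 /cofactor.
rewrite !(expand_det_row _ (0 : 'I_2)) !big_ord_recl !big_ord0 /cofactor.
by rewrite !det_mx11 !mxE /=; ring.
Qed.

Lemma det3_neq0 p q r : (det3 p q r != 0) = (\rank (p + q + r)%MS == 3%N).
Proof.
rewrite /det3 -unitfE -unitmxE -row_free_unit /row_free -addsmxA.
rewrite -(addsmxE p (col_mx q r)).
by rewrite (adds_eqmx (eqmx_refl p) (addsmxE q r)).
Qed.

Lemma rank2_of_det3 p q r : det3 p q r != 0 -> \rank (q + r)%MS = 2%N.
Proof.
rewrite det3_neq0 -addsmxA => /eqP rk3; apply/eqP; rewrite eqn_leq.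
have [h1 h2] := (mxrank_adds_leqif p (q + r)%MS, mxrank_adds_leqif q r).
have := leq_trans h2 (leq_add (rank_leq_row q) (rank_leq_row r)).
move=> ->; have := leq_trans h1 (leq_add (rank_leq_row p) (leqnn _)).
by rewrite rk3 ltnS.
Qed.

(** The point [p] witnesses that [q] and [r] span a line of rank 2; adding [f] raises the rank to 3
    exactly when [f] is off that line. *)
Lemma det3_eq0_sub f p q r :
  det3 p q r != 0 -> (f <= q + r)%MS = (det3 f q r == 0).
Proof.
move=> /rank2_of_det3 rk2; apply/idP/idP => [sub|].
  apply: contraTT sub; rewrite det3_neq0 -addsmxA => /eqP rk3.
  apply/negP=> sub; move: rk3.
  by rewrite (addsmx_idPr sub) rk2.
apply: contraTT => nsub; rewrite det3_neq0 -addsmxA eqn_leq rank_leq_col /=.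
suff: (\rank (q + r)%MS < \rank (f + (q + r))%MS)%N by rewrite rk2.
rewrite (ltn_leqif (mxrank_leqif_sup (addsmxSr f _))).
by rewrite addsmx_sub (negPf nsub).
Qed.

Lemma meet_unique p1 p2 q1 r1 q2 r2 f g :
  det3 p1 q1 r1 != 0 -> det3 p2 q2 r2 != 0 -> det3 q1 r1 q2 != 0 ->
  f != 0 -> g != 0 ->
  (f <= q1 + r1)%MS -> (f <= q2 + r2)%MS ->
  (g <= q1 + r1)%MS -> (g <= q2 + r2)%MS -> (g == f)%MS.
Proof.
move=> /rank2_of_det3 rk1 /rank2_of_det3 rk2; rewrite det3_neq0 => /eqP rk3.
move=> f0 g0 f1 f2 g1 g2.
have rk4 : \rank ((q1 + r1) + (q2 + r2))%MS = 3%N.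
  apply/eqP; rewrite eqn_leq rank_leq_col /= -[X in (X <= _)%N]rk3.
  by rewrite mxrankS // addsmxS // addsmxSl.
have := mxrank_sum_cap (q1 + r1)%MS (q2 + r2)%MS.
rewrite rk1 rk2 rk4.
move=> -[]; rewrite add0n => rkI.
have eqI (h : 'rV[K]_3) : h != 0 -> (h <= q1 + r1)%MS -> (h <= q2 + r2)%MS ->
    (h :=: (q1 + r1) :&: (q2 + r2))%MS.
  move=> h0 h1 h2; have hI : (h <= (q1 + r1) :&: (q2 + r2))%MS.
    by rewrite sub_capmx h1.
  by apply/eqmxP; case: (mxrank_leqif_eq hI) => _ <-; rewrite rank_rV h0 rkI.
by apply/eqmxP; apply: eqmx_trans (eqmx_sym (eqI _ f0 f1 f2)); exact: eqI.
Qed.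

Lemma qformZ A a x : qform A (a *: x) = a ^+ 2 * qform A x.
Proof. by rewrite !qformE !big_ord3 !mxE; ring. Qed.

(** * Orthogonality of lines through the polar form [absform] of the absolute conic *)

Definition absform x y : K := (x *m absolute *m y^T) 0 0.

Lemma absformE x y :
  absform x y = x 0 1 * y 0 1 + x 0 2 * y 0 2 - x 0 0 * y 0 0.
Proof. by rewrite /absform mxE big_ord3 !mxE !big_ord3 !mxE /=; ring. Qed.

Lemma is_pole_adds x p q : is_pole absolute x (p + q)%MS <->
  [/\ x != 0, absform p x = 0 & absform q x = 0].
Proof.
have absform0 y : absform y x = 0 <-> y *m (absolute *m x^T) = 0.
  rewrite mulmxA /absform; split=> [y0|->]; last by rewrite mxE.
  by apply/matrixP=> i j; rewrite !ord1 y0 mxE.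
split=> [[x0 /eqP]|[x0 /absform0/eqP px /absform0/eqP qx]].
  rewrite -mulmxA -sub_kermx addsmx_sub !sub_kermx.
  by case/andP=> /eqP/absform0 px /eqP/absform0 qx.
split=> //; apply/eqP.
by rewrite -mulmxA -sub_kermx addsmx_sub !sub_kermx px qx.
Qed.

(* The Gram determinant of (p, q) against (p, r): up to sign, the polar form of
   the dual absolute conic at the coordinates of the lines pq and pr. *)
Definition line_gram p q r : K :=
  absform p p * absform q r - absform p q * absform p r.

Lemma absformDr x y z : absform x (y + z) = absform x y + absform x z.
Proof. by rewrite !absformE !mxE; ring. Qed.

Lemma absformZr x a y : absform x (a *: y) = a * absform x y.
Proof. by rewrite !absformE !mxE; ring. Qed.

Lemma absformC x y : absform x y = absform y x.
Proof. by rewrite !absformE; ring. Qed.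

(** A pole of [p + q] lying on [p + r] is a combination [a *: p + b *: r] solving two linear
    equations in [a] and [b], whose determinant is [line_gram p q r]. *)
Lemma orthogonal_gram p q r : det3 p q r != 0 ->
  orthogonal_lines (p + q)%MS (p + r)%MS <-> line_gram p q r = 0.
Proof.
move=> det0.
have comb_neq0 a b : (a, b) != (0, 0) -> a *: p + b *: r != 0.
  apply: contraNneq => comb0; apply/eqP.
  have [a0 b0] : a * det3 p q r = 0 /\ b * det3 p q r = 0.
    have -> : a * det3 p q r = det3 (a *: p + b *: r) q r.
      by rewrite !det3E !mxE; ring.
    have -> : b * det3 p q r = det3 p q (a *: p + b *: r).
      by rewrite !det3E !mxE; ring.
    by rewrite comb0 !det3E !mxE; split; ring.
  move/eqP: a0; move/eqP: b0; rewrite !mulf_eq0 (negPf det0) !orbF.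
  by move=> /eqP-> /eqP->.
split=> [[x [/is_pole_adds[x0 px qx]]]|gram0].
  case/sub_addsmxP=> -[/= u v] defx.
  move: px qx x0; rewrite {x}defx (mx11_scalar u) (mx11_scalar v).
  rewrite !mul_scalar_mx !absformDr !absformZr.
  set a := u 0 0; set b := v 0 0 => px qx.
  apply: contraNeq => gram_neq0.
  (* Cramer's rule for the two equations [px] and [qx]. *)
  have [a0 b0] : a * line_gram p q r = 0 /\ b * line_gram p q r = 0.
    rewrite /line_gram (absformC p q); split.
      transitivity (absform q r * (a * absform p p + b * absform p r)
        - absform p r * (a * absform q p + b * absform q r)); first by ring.
      by rewrite px qx; ring.
    transitivity (absform p p * (a * absform q p + b * absform q r)
      - absform q p * (a * absform p p + b * absform p r)); first by ring.
    by rewrite px qx; ring.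
  move/eqP: a0; move/eqP: b0; rewrite !mulf_eq0 (negPf gram_neq0) !orbF.
  by move=> /eqP-> /eqP->; rewrite !scale0r addr0.
suff [a [b [ab0 pab qab]]] : exists a b, [/\ (a, b) != (0, 0),
    a * absform p p + b * absform p r = 0
  & a * absform q p + b * absform q r = 0].
  exists (a *: p + b *: r); split; last first.
    by rewrite addmx_sub_adds ?scalemx_sub.
  apply/is_pole_adds; rewrite !absformDr !absformZr; split=> //.
  exact: comb_neq0.
move: gram0; rewrite /line_gram (absformC p q) => gram0.
(* A kernel vector of the singular system is read off a nonzero row; if both rows vanish up to the
   last coefficient, (1, 0) works. *)
have [pp0|pp_neq0] := eqVneq (absform p p) 0; last first.
  exists (absform p r), (- absform p p); rewrite xpair_eqE oppr_eq0.
  rewrite (negPf pp_neq0) andbF; split=> //; first by ring.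
  by rewrite -[RHS]oppr0 -gram0; ring.
have [pr0|pr_neq0] := eqVneq (absform p r) 0; last first.
  exists (absform p r), (- absform p p); rewrite xpair_eqE.
  rewrite (negPf pr_neq0); split=> //; first by ring.
  by rewrite -[RHS]oppr0 -gram0; ring.
have [qp0|qp_neq0] := eqVneq (absform q p) 0.
  exists 1, 0; rewrite xpair_eqE oner_eq0.
  by rewrite pp0 qp0; split=> //; ring.
exists (absform q r), (- absform q p); rewrite xpair_eqE oppr_eq0.
by rewrite (negPf qp_neq0) andbF pp0 pr0; split=> //; ring.
Qed.

End Plane.

(** * The osculating conic: parametrisation, Frégier collineation, hypotenuses *)

Section OsculatingConic.
Variables (K : fieldType) (l : K).
Hypotheses (nz2 : 2 != 0 :> K) (nzl : l != 0).
Implicit Types (p q r x y : 'rV[K]_3).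

Local Notation C := (osc_conic l).

Lemma conic_pointsE x : conic_points C x <->
  x != 0 /\ l * (x 0 1 ^+ 2 + x 0 2 ^+ 2 - x 0 0 ^+ 2)
            + (x 0 0 + x 0 1) * x 0 2 = 0.
Proof. by rewrite /conic_points /= qform_osc_conic. Qed.

Lemma conic_coord_eq0 x : conic_points C x ->
  x 0 0 + x 0 1 = 0 -> x 0 1 = - x 0 0 /\ x 0 2 = 0.
Proof.
move=> /conic_pointsE[_ xC] x01.
have x1 : x 0 1 = - x 0 0 by apply/eqP; rewrite -addr_eq0 addrC x01.
have /eqP : l * x 0 2 ^+ 2 = 0 by rewrite -xC x1; ring.
by rewrite mulf_eq0 (negPf nzl) expf_eq0 /= => /eqP.
Qed.

(** Stereographic projection from the osculation point [1, -1, 0], which has parameter [0 : 1];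
    elsewhere [a : b] is [x_0 + x_1 : x_2]. *)
Definition conic_param (a b : K) : 'rV[K]_3 :=
  vec3 (l * a ^+ 2 + l * b ^+ 2 + a * b) (l * a ^+ 2 - l * b ^+ 2 - a * b)
       (2 * l * a * b).

Lemma conic_param_points a b : (a, b) != (0, 0) ->
  conic_points C (conic_param a b).
Proof.
move=> ab0; apply/conic_pointsE; rewrite !mxE /=; split; last by ring.
apply: contraNneq ab0 => /rowP ab0.
have := (ab0 0, ab0 1); rewrite !mxE /= => -[e0 e1].
have /eqP : 2 * l * a ^+ 2 = 0.
  by have := congr2 +%R e0 e1; rewrite addr0 => <-; ring.
rewrite mulf_eq0 (negPf (mulf_neq0 nz2 nzl)) expf_eq0 /= => /eqP a0.
move: e0; rewrite a0 expr0n mulr0 mul0r add0r addr0 => /eqP.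
by rewrite mulf_eq0 (negPf nzl) expf_eq0 /= => /eqP->.
Qed.

Lemma conic_param_surj x : conic_points C x ->
  exists c a b, x = c *: conic_param a b.
Proof.
move=> Cx; have [_ xC] := (conic_pointsE x).1 Cx.
have [x01|nz] := eqVneq (x 0 0 + x 0 1) 0.
  have [x1 x2] := conic_coord_eq0 Cx x01.
  exists (x 0 0 / l), 0, 1; apply: rowvec3P; rewrite !mxE /= x1 x2.
  by split; field.
exists ((x 0 0 + x 0 1) / (2 * l)), 1, (x 0 2 / (x 0 0 + x 0 1)).
(* The equation of the conic is linear in [x 0 0 - x 0 1] once [x 0 0 + x 0 1] is given. *)
have e : l * (x 0 0 - x 0 1) * (x 0 0 + x 0 1) =
         l * x 0 2 ^+ 2 + (x 0 0 + x 0 1) * x 0 2.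
  by apply/eqP; rewrite -subr_eq0 -oppr_eq0; apply/eqP; rewrite -xC; ring.
have e' : x 0 0 - x 0 1 =
    (l * x 0 2 ^+ 2 + (x 0 0 + x 0 1) * x 0 2) / (l * (x 0 0 + x 0 1)).
  by rewrite -e; field; rewrite nz nzl.
apply: rowvec3P; rewrite !mxE /=; split.
- transitivity (((x 0 0 + x 0 1) + (x 0 0 - x 0 1)) / 2); first by field.
  by rewrite e'; field; rewrite nz nzl nz2.
- transitivity (((x 0 0 + x 0 1) - (x 0 0 - x 0 1)) / 2); first by field.
  by rewrite e'; field; rewrite nz nzl nz2.
- by field; rewrite nz nzl nz2.
Qed.

(** A homogeneous Vandermonde determinant. *)
Lemma det3_conic_param e f a b c d :
  det3 (conic_param e f) (conic_param a b) (conic_param c d) =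
  4 * l ^+ 3 * (e * b - f * a) * (e * d - f * c) * (a * d - b * c).
Proof. by rewrite det3E !mxE /=; ring. Qed.

(* On the parameters of the conic, the orthogonality of the lines joining
   [e : f] to [a : b] and to [c : d] is the vanishing of this bilinear form;
   the factors due to [a : b] = [e : f] and [c : d] = [e : f] are removed. *)
Definition orth_form (e f a b c d : K) : K :=
  (l * (b * e - f * a) + a * e) * (l * (d * e - f * c) + c * e)
  + 4 * l * e * f * a * c.

Lemma gram_conic_param e f a b c d :
  line_gram (conic_param e f) (conic_param a b) (conic_param c d) =
  - 4 * l ^+ 2 * (e * b - f * a) * (e * d - f * c) * orth_form e f a b c d.
Proof. by rewrite /line_gram !absformE !mxE /= /orth_form; ring. Qed.

(* 2 A N^-1 - tr(A N^-1) I, acting on row vectors. *)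
Definition fregier_mx : 'M[K]_3 :=
  \matrix_(i < 3, j < 3)
    (nth [::] [:: [:: - l; 0;   1];
                  [:: 0;   - l; 1];
                  [:: - 1; 1;   - l]] i)`_j.

Lemma mul_fregier_mx x : x *m fregier_mx =
  vec3 (- l * x 0 0 - x 0 2) (- l * x 0 1 + x 0 2)
       (- l * x 0 2 + x 0 0 + x 0 1).
Proof. by apply: rowvec3P; rewrite !mxE !big_ord3 !mxE /=; split; ring. Qed.

(** The key identity: the factor [orth_form] that expresses the right angle at the vertex also
    expresses that the image of the vertex lies on the hypotenuse. *)
Lemma det3_fregier_mx e f a b c d :
  det3 (conic_param e f *m fregier_mx) (conic_param a b) (conic_param c d) =
  - 4 * l ^+ 2 * (a * d - b * c) * orth_form e f a b c d.
Proof. by rewrite mul_fregier_mx det3E !mxE /= /orth_form; ring. Qed.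

(* fregier_mx = n - l I with n ^ 3 = 0, so its product with n ^ 2 + l n + l ^ 2
   is the scalar matrix of - l ^ 3. *)
Lemma fregier_mx_unit : fregier_mx \in unitmx.
Proof.
pose B : 'M[K]_3 := \matrix_(i < 3, j < 3)
  (- l ^- 3 * (nth [::] [:: [:: l ^+ 2 - 1; 1;            l];
                            [:: - 1;        l ^+ 2 + 1;   l];
                            [:: - l;        l;       l ^+ 2]] i)`_j).
suff /mulmx1_unit[] : fregier_mx *m B = 1%:M by [].
apply/matrixP=> -[[|[|[|i]]] ?] -[[|[|[|j]]] ?] //;
  by rewrite mxE big_ord3 !mxE /=; field.
Qed.

Lemma fregier_mx_neq0 p : p != 0 -> p *m fregier_mx != 0.
Proof.
apply: contraNneq => pF0.
by rewrite -(mulmxK fregier_mx_unit p) pF0 mul0mx.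
Qed.

Lemma mul_osc_conic x : x *m C =
  vec3 (x 0 2 / 2 - l * x 0 0) (x 0 2 / 2 + l * x 0 1)
       ((x 0 0 + x 0 1) / 2 + l * x 0 2).
Proof. by apply: rowvec3P; rewrite !mxE !big_ord3 !mxE /=; split; ring. Qed.

Lemma mul_absolute x : x *m absolute = vec3 (- x 0 0) (x 0 1) (x 0 2).
Proof. by apply: rowvec3P; rewrite !mxE !big_ord3 !mxE /=; split; ring. Qed.

(** The line x_0 + x_1 = 0 meets the conic only at the osculation point, the sole point of
    tangency. *)
Lemma tangent_absoluteP p : conic_points C p ->
  tangent_to_absolute_at C p <-> p 0 0 + p 0 1 = 0.
Proof.
move=> pC; have p_neq0 : p != 0 by case: pC.
split=> [[_ _ /andP[/sub_rVP[c /rowP eqt] _]]|p01].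
  have := (eqt 0, eqt 1, eqt 2); rewrite mul_osc_conic mul_absolute !mxE /=.
  set x := p 0 0; set y := p 0 1; set z := p 0 2.
  move=> -[[e0 e1] e2].
  have x2 : z = 2 * (l - c) * x.
    transitivity (2 * (z / 2 - l * x) + 2 * l * x); first by field.
    by rewrite e0; ring.
  have y2 : z = 2 * (c - l) * y.
    transitivity (2 * (z / 2 + l * y) - 2 * l * y); first by field.
    by rewrite e1; ring.
  have z2 : x + y = 2 * (c - l) * z.
    transitivity (2 * ((x + y) / 2 + l * z) - 2 * l * z); first by field.
    by rewrite e2; ring.
  (* Proportionality of the two tangents, with factor [c], gave three equations; eliminating [c]
     between them leaves (x + y)^2 = 0. *)
  have m0 : 2 * (c - l) * (x + y) = 0.
    by rewrite mulrDr -y2 [X in _ + X]x2; ring.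
  have : (x + y) ^+ 2 = 0.
    transitivity (z * (2 * (c - l) * (x + y))); last by rewrite m0 mulr0.
    by rewrite [in LHS]expr2 {1}z2; ring.
  by move/eqP; rewrite expf_eq0 /= => /eqP.
have [p1 p2] := conic_coord_eq0 pC p01.
split=> //.
  by split=> //; rewrite qform_absolute p1 p2; ring.
have -> : p *m C = l *: (p *m absolute).
  rewrite mul_osc_conic mul_absolute.
  by apply: rowvec3P; rewrite !mxE /= p1 p2; split; field.
by apply/eqmxP; apply: eqmx_scale.
Qed.

(** The nilpotent part of [fregier_mx] kills [1, -1, 0], so the collineation fixes the point of
    tangency, as the convention there demands. *)
Lemma fregier_mx_tangent p : conic_points C p ->
  tangent_to_absolute_at C p -> p *m fregier_mx = - l *: p.
Proof.
move=> pC /(tangent_absoluteP pC) p01.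
have [p1 p2] := conic_coord_eq0 pC p01.
by apply: rowvec3P; rewrite mul_fregier_mx !mxE /= p1 p2; split; ring.
Qed.

Lemma fregier_mx_hypotenuse p q r : inscribed_right_triangle C p q r ->
  (p *m fregier_mx <= q + r)%MS.
Proof.
move=> [rk3 [pC qC rC] orth].
have det0 : det3 p q r != 0 by rewrite det3_neq0 rk3.
have {orth} := (orthogonal_gram det0).1 orth.
rewrite (det3_eq0_sub _ det0); move: det0.
have [cp [e [f ->]]] := conic_param_surj pC.
have [cq [a [b ->]]] := conic_param_surj qC.
have [cr [c [d ->]]] := conic_param_surj rC.
have det3Z x y z : det3 (cp *: x) (cq *: y) (cr *: z) =
    cp * cq * cr * det3 x y z by rewrite !det3E !mxE; ring.
rewrite -scalemxAl !det3Z det3_conic_param det3_fregier_mx.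
have -> : line_gram (cp *: conic_param e f) (cq *: conic_param a b)
    (cr *: conic_param c d) = cp ^+ 2 * (cq * cr) *
    line_gram (conic_param e f) (conic_param a b) (conic_param c d).
  by rewrite /line_gram !absformE !mxE; ring.
(* Multiplied by the nonzero triangle determinant, the incidence determinant becomes a multiple of
   the Gram determinant, which vanishes. *)
rewrite gram_conic_param => det0 gram0; apply/eqP/(mulIf det0); rewrite mul0r.
rewrite -[RHS](mul0r (cq * cr * 4 * l ^+ 3 * (a * d - b * c) ^+ 2)) -gram0.
by ring.
Qed.

End OsculatingConic.

(** In characteristic zero the [size P] integers from 0 on are distinct, one more than the degree
    allows as roots. *)
Lemma exists_nonroot (K : numFieldType) (P : {poly K}) :
  P != 0 -> exists x, ~~ root P x.
Proof.
move=> P0; apply: contrapT => allroot.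
pose s : seq K := [seq n%:R | n <- iota 0 (size P)].
have : (size s < size P)%N.
  apply: max_poly_roots => //; last first.
    by rewrite map_inj_uniq ?iota_uniq //; apply: Num.Theory.mulrIn;
      rewrite oner_eq0.
  apply/allP=> x _; apply: contrapT => /negP nroot.
  by apply: allroot; exists x.
by rewrite size_map size_iota ltnn.
Qed.

(** * Uniqueness of the Frégier point, and the locus as an image conic *)

Section FregierLocus.
Variables (K : numFieldType) (l : K).
Hypothesis nzl : l != 0.
Implicit Types (p q r f g x : 'rV[K]_3).

Local Notation C := (osc_conic l).
Local Notation F := (fregier_mx l).
Let nz2 : 2 != 0 :> K. Proof. by rewrite Num.Theory.pnatr_eq0. Qed.
Let nz4 : 4 != 0 :> K. Proof. by rewrite Num.Theory.pnatr_eq0. Qed.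

(* The lines through [e : u] are given by a parameter in which the involution of
   right angles reads k * s = const and the vertex has parameter 1. *)
Definition leg_end (e u k : K) := conic_param l (l * e) (l * u + (k - 1) * e).

Lemma leg_end_points e u k : e != 0 -> conic_points C (leg_end e u k).
Proof.
move=> e0; apply: conic_param_points => //.
by rewrite xpair_eqE mulf_eq0 (negPf nzl) (negPf e0).
Qed.

(** Here [orth_form] is a multiple of [k * s * e + 4 * l * u]; the three inequalities keep the
    vertices distinct. *)
Lemma leg_end_right_triangle c e u k s : c != 0 -> e != 0 ->
  k * s * e = - 4 * l * u -> k != 1 -> s != 1 -> k != s ->
  inscribed_right_triangle C (c *: conic_param l e u)
    (leg_end e u k) (leg_end e u s).
Proof.
move=> c0 e0 kse k1 s1 ks.
have det0 : det3 (c *: conic_param l e u) (leg_end e u k) (leg_end e u s) != 0.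
  have -> : det3 (c *: conic_param l e u) (leg_end e u k) (leg_end e u s) =
      4 * (c * l ^+ 4 * e ^+ 6) * ((k - 1) * (s - 1) * (s - k)).
    transitivity
      (c * det3 (conic_param l e u) (leg_end e u k) (leg_end e u s)).
      by rewrite !det3E !mxE; ring.
    by rewrite det3_conic_param; ring.
  by rewrite !mulf_neq0 ?expf_neq0 ?subr_eq0 // eq_sym.
split; first by apply/eqP; rewrite -det3_neq0.
  split; try exact: leg_end_points.
  have [nz xC] : conic_points C (conic_param l e u).
    by apply: conic_param_points => //; rewrite xpair_eqE (negPf e0).
  by split; [rewrite scaler_eq0 negb_or c0 | rewrite qformZ xC mulr0].
apply/(orthogonal_gram det0).
transitivity (c ^+ 2 *
  line_gram (conic_param l e u) (leg_end e u k) (leg_end e u s)).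
  by rewrite /line_gram !absformE !mxE; ring.
rewrite gram_conic_param.
have -> : orth_form l e u (l * e) (l * u + (k - 1) * e)
    (l * e) (l * u + (s - 1) * e) = l ^+ 2 * e ^+ 3 * (k * s * e + 4 * l * u).
  by rewrite /orth_form; ring.
by rewrite kse; ring.
Qed.

(** Two right triangles at [p] with different hypotenuses suffice: both points lie on the
    intersection. *)
Lemma on_all_hypotenuses_unique p f g :
  conic_points C p -> ~ tangent_to_absolute_at C p ->
  on_all_hypotenuses C p f -> on_all_hypotenuses C p g -> (g == f)%MS.
Proof.
move=> pC /(tangent_absoluteP nz2 nzl pC) p01 [f0 fall] [g0 gall].
have [c [e [u defp]]] := conic_param_surj nz2 nzl pC.
have [c0 e0] : c != 0 /\ e != 0.
  apply/andP; rewrite -negb_or; apply/negP => /orP ce; apply: p01.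
  by rewrite defp !mxE /=; case: ce => /eqP->; ring.
pose d := - 4 * l * u / e.
have dE k : k != 0 -> k * (d / k) * e = - 4 * l * u.
  by move=> k0; rewrite /d; field; rewrite k0.
(* The legs [k] and [d / k] are orthogonal. The roots of [P] are the degenerate choices: [k] zero, a
   leg ending at the vertex, or both legs equal. *)
pose P : {poly K} := 'X * ('X - 1%:P) * ('X - d%:P) * ('X ^+ 2 - d%:P).
have P0 : P != 0.
  rewrite !mulf_neq0 ?polyX_eq0 ?polyXsubC_eq0 //.
  by rewrite -size_poly_eq0 size_XnsubC.
have PE k : ~~ root P k -> [/\ k != 0, k != 1, d / k != 1 & k != d / k].
  rewrite /root !hornerE !mulf_eq0 !negb_or !subr_eq0.
  move=> /andP[/andP[/andP[k0 k1] kd] k2]; split=> //.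
    by apply: contraNneq kd => /(divr1_eq)->.
  apply: contraNneq k2 => kdk.
  have <- : k * (d / k) = d by rewrite mulrC divfK.
  by rewrite -kdk.
have [k1 /PE[k10 k11 k1d k12]] := exists_nonroot P0.
(* Avoiding [k1] and [d / k1] keeps an endpoint of the second hypotenuse off the first one. *)
have [k2] : exists k, ~~ root (P * ('X - k1%:P) * ('X - (d / k1)%:P)) k.
  by apply/exists_nonroot/mulf_neq0; rewrite ?(mulf_neq0 P0) ?polyXsubC_eq0.
rewrite 2!rootM !root_XsubC !negb_or.
move=> /andP[/andP[/PE[k20 k21 k2d k22] n1] n2].
have tri1 := leg_end_right_triangle c0 e0 (dE _ k10) k11 k1d k12.
have tri2 := leg_end_right_triangle c0 e0 (dE _ k20) k21 k2d k22.
rewrite -defp in tri1 tri2.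
have det_tri q r : inscribed_right_triangle C p q r -> det3 p q r != 0.
  by case=> rk _ _; rewrite det3_neq0 rk.
apply: (meet_unique (det_tri _ _ tri1) (det_tri _ _ tri2)) => //;
  try by [apply: fall | apply: gall].
rewrite det3_conic_param.
have -> : 4 * l ^+ 3 *
   (l * e * (l * u + (d / k1 - 1) * e) - (l * u + (k1 - 1) * e) * (l * e)) *
   (l * e * (l * u + (k2 - 1) * e) - (l * u + (k1 - 1) * e) * (l * e)) *
   (l * e * (l * u + (k2 - 1) * e) - (l * u + (d / k1 - 1) * e) * (l * e)) =
   4 * (l ^+ 6 * e ^+ 6) * ((d / k1 - k1) * (k2 - k1) * (k2 - d / k1)).
  by field.
by rewrite !mulf_neq0 ?expf_neq0 ?subr_eq0 // eq_sym.
Qed.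

Lemma fregier_point_mx p f : conic_points C p ->
  is_fregier_point C p f <-> f != 0 /\ (f == p *m F)%MS.
Proof.
move=> pC; have p_neq0 : p != 0 by case: pC.
have allF : on_all_hypotenuses C p (p *m F).
  split; first exact: fregier_mx_neq0.
  by move=> q r /(fregier_mx_hypotenuse nz2 nzl).
have [tgt|ntgt] := pselect (tangent_to_absolute_at C p).
  have eqF : (p *m F :=: p)%MS.
    rewrite (fregier_mx_tangent nz2 nzl) //; apply: eqmx_scale.
    by rewrite oppr_eq0.
  have -> : (f == p *m F)%MS = (f == p)%MS by rewrite !eqF.
  by split=> [[[_]|[]]|] //; left.
split=> [[[]|[_ [[f0 _] uniqf]]]|[f0 eqf]] //.
  by split=> //; apply/eqmxP/eqmx_sym/eqmxP/uniqf.
right; split=> //; split; last first.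
  move=> g; apply: on_all_hypotenuses_unique => //; split=> // q r tri.
  by rewrite (eqmxP eqf); exact: allF.2.
by split=> // q r tri; rewrite (eqmxP eqf); exact: allF.2.
Qed.

Lemma regular_fregier_locus : regular_conic (fregier_locus C).
Proof.
have Fu := fregier_mx_unit nzl.
have [symC Cu] := osc_conic_regular nz2 nzl.
have qformF x : qform (invmx F *m C *m (invmx F)^T) x = qform C (x *m invmx F).
  by rewrite /qform trmx_mul !mulmxA.
(* The coefficient matrix of the image of the conic under [F], by congruence with the inverse. *)
exists (invmx F *m C *m (invmx F)^T); split.
  split; first by rewrite !trmx_mul trmxK symC mulmxA.
  by rewrite !unitmx_mul unitmx_tr unitmx_inv Fu Cu.
apply/seteqP; split=> [f [p pC /(fregier_point_mx _ pC)[f0 eqf]]|f [f0 fM]].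
  split=> //; rewrite qformF.
  have /sub_rVP[a ->] : (f <= p *m F)%MS by rewrite (eqmxP eqf).
  by case: pC => _ /= pC; rewrite -scalemxAl mulmxK // qformZ pC mulr0.
have pC : conic_points C (f *m invmx F).
  split; last by rewrite -qformF.
  by apply: contraNneq f0 => p0; rewrite -(mulmxKV Fu f) p0 mul0mx.
exists (f *m invmx F) => //; apply/(fregier_point_mx _ pC).
by rewrite mulmxKV //; split=> //; apply/eqmxP.
Qed.

End FregierLocus.

Theorem mainTheorem6 (R : realType) (lambda : R) (lambda_neq0 : lambda != 0) :
  regular_conic (fregier_locus (@osc_conic R[i]%C lambda%:C%C)).
Proof. by apply: regular_fregier_locus; rewrite eq_complex /= eqxx andbT. Qed.
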